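(* (i) If $\mathcal{H}$ is a 3-uniform hypergraph on $n$ vertices without isolated vertices, then $\gamma_g'(\mathcal{H})\le \frac{5}{9}n$. (ii) If $G$ is a graph of order $n$ without isolated vertices in which every edge belongs to a triangle, then $\gamma_g'(G)\le \frac{5}{9}n$.
   Context: Hypergraphs and graphs are finite. In a hypergraph (or graph), two distinct vertices are adjacent if some edge contains both; $N[v]$ is $v$ together with all vertices adjacent to $v$, and $N[S]=\bigcup_{v\in S}N[v]$. The domination game: Dominator and Staller alternately choose vertices $v_1,v_2,\dots$; with $D_i=\{v_1,\dots,v_i\}$, each chosen vertex must satisfy $N[v_i]\setminus N[D_{i-1}]\ne\emptyset$, and the game ends when $N[D_d]$ is the whole vertex set. Dominator aims to minimize the number of moves, Staller to maximize it. $\gamma_g'$ denotes the number of moves under optimal play when Staller makes the first move. *)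

(* Defs.v *)
From mathcomp Require Import all_boot.
Set Implicit Arguments. Unset Strict Implicit. Unset Printing Implicit Defensive.

Definition hadj (V : finType) (E : {set {set V}}) (u v : V) : bool :=
  (u != v) && [exists e in E, (u \in e) && (v \in e)].

Definition hN (V : finType) (E : {set {set V}}) (v : V) : {set V} :=
  v |: [set u | hadj E v u].

Definition gN (V : finType) (e : rel V) (v : V) : {set V} :=
  v |: [set u | e v u].

(* Value of the domination game determined by closed neighbourhoods N, under
   optimal play.  [S] is the set of already dominated vertices N[D], [dom]
   tells whether Dominator is to move, [k] is fuel (the number of undominated
   vertices is an upper bound on the number of remaining moves, since every
   legal move dominates a new vertex).  A move v is legal iff N v is not
   contained in S.  Dominator minimizes, Staller maximizes. *)
Fixpoint game_val (V : finType) (N : V -> {set V}) (k : nat) (dom : bool)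
    (S : {set V}) : nat :=
  match k with
  | 0 => 0
  | k'.+1 =>
    if S == setT then 0 else
    if dom then
      \big[minn/#|V|]_(v | ~~ (N v \subset S)) (game_val N k' false (S :|: N v)).+1
    else
      \max_(v | ~~ (N v \subset S)) (game_val N k' true (S :|: N v)).+1
  end.

Definition gamma_g' (V : finType) (N : V -> {set V}) : nat :=
  game_val N #|V| false set0.

(* Main.v *)
(** Discharging.  Call a vertex white while it is undominated and blue once it
    is dominated but still has white neighbours.  A white vertex weighs 45; a
    blue vertex with 1, 2 or at least 3 white neighbours weighs 18, 21 or 25;
    all other vertices weigh 0.  The game starts with weight 45 n, and Staller's
    first move removes at least 45 + 2 * 20 >= 81.  Afterwards Dominator can
    always move so that his move together with any reply of Staller removes at
    least 162 = 2 * 81, or his own move, if it ends the game, at least 81;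
    hence 81 times the number of moves is at most 45 n.

    Any reply removes at least 38, so Dominator wins a round at once when some
    move removes at least 124.  Otherwise the position is very sparse: every
    white vertex has at most two white neighbours, there are no white
    triangles, and the white edges at a vertex form triangles with different
    blue vertices.  Dominator then plays a vertex with two white neighbours, or
    else an end of an isolated white edge, or else a blue vertex with two white
    neighbours, or else any white vertex. *)

Require Import Defs.
From mathcomp Require Import all_boot zify.

Set Implicit Arguments. Unset Strict Implicit. Unset Printing Implicit Defensive.

Definition bw (k : nat) : nat :=
  match k with 0 => 0 | 1 => 18 | 2 => 21 | _ => 25 end.

Lemma bw_le25 k : bw k <= 25.
Proof. by case: k => [|[|[|k]]]. Qed.

Lemma bw_ge18 k : 0 < k -> 18 <= bw k.
Proof. by case: k => [|[|[|k]]]. Qed.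

Lemma bw_ge21 k : 1 < k -> 21 <= bw k.
Proof. by case: k => [|[|[|k]]]. Qed.

Lemma bw_ge25 k : 2 < k -> 25 <= bw k.
Proof. by case: k => [|[|[|k]]]. Qed.

Lemma bw_mono j k : j <= k -> bw j <= bw k.
Proof. by case: j k => [|[|[|j]]] [|[|[|k]]]. Qed.

(** * The potential *)

Section Potential.
Variables (V : finType) (e : rel V).

(* [S] is the set of dominated vertices, so [wn S u] is the set of white
   neighbours of [u]. *)
Definition wn (S : {set V}) (u : V) : {set V} := [set z | e u z] :\: S.
Definition wd (S : {set V}) (u : V) : nat := #|wn S u|.
Definition wt (S : {set V}) (u : V) : nat := if u \in S then bw (wd S u) else 45.
Definition pot (S : {set V}) : nat := \sum_u wt S u.
Definition nx (S : {set V}) (v : V) : {set V} := S :|: gN e v.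

Implicit Types (S : {set V}) (u v : V).

Lemma in_nx S v u : (u \in nx S v) = [|| u \in S, u == v | e v u].
Proof. by rewrite !inE. Qed.

Lemma in_wn S v (z : V) : (z \in wn S v) = e v z && (z \notin S).
Proof. by rewrite !inE andbC. Qed.

Lemma wd_subset (S T : {set V}) u : S \subset T -> wd T u <= wd S u.
Proof. by move=> ST; apply/subset_leq_card/setDS. Qed.

Lemma wt_subset (S T : {set V}) u : S \subset T -> wt T u <= wt S u.
Proof.
move=> ST; rewrite /wt; have [uS|uS] := boolP (u \in S).
  by rewrite (subsetP ST) // bw_mono ?wd_subset.
by case: ifP => // _; apply: leq_trans (bw_le25 _) _.
Qed.

Lemma nx_subset S v : S \subset nx S v.
Proof. exact: subsetUl. Qed.

Lemma wd_drop l S v u :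
    uniq l -> all (fun z => [&& e u z, z \notin S & z \in nx S v]) l ->
  wd (nx S v) u + size l <= wd S u.
Proof.
move=> Ul /allP Hl; rewrite -(card_uniqP Ul) -cardUI.
rewrite [X in _ + X]eq_card0 ?addn0 => [|z].
  apply/subset_leq_card/subsetP => z; rewrite !inE => /orP[|/Hl /and3P[-> -> _]//].
  by rewrite negb_or -andbA => /and3P[-> _ ->].
rewrite !inE; apply/negP=> /andP[/andP[zn _] /Hl /and3P[_ _]].
by rewrite in_nx => zn'; move: zn; rewrite zn'.
Qed.

Lemma wd_ge l S u :
  uniq l -> all (fun z => e u z && (z \notin S)) l -> size l <= wd S u.
Proof.
move=> Ul /allP Hl; rewrite -(card_uniqP Ul).
by apply/subset_leq_card/subsetP => z /Hl; rewrite in_wn.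
Qed.

Lemma wd_other l S u : size l < wd S u ->
  exists z, [/\ e u z, z \notin S & z \notin l].
Proof.
move=> lt_l; have /subsetPn[z] : ~~ (wn S u \subset l).
  apply/negP=> /subset_leq_card; rewrite leqNgt.
  by rewrite (leq_ltn_trans (card_size _) lt_l).
by rewrite in_wn => /andP[? ?] ?; exists z.
Qed.

Lemma wd_eq0 S u (z : V) : wd S u = 0 -> e u z -> z \in S.
Proof.
move=> /eqP; rewrite cards_eq0 => /eqP w0 uz; apply/negPn/negP => zS.
by have := in_set0 z; rewrite -w0 in_wn uz zS.
Qed.

(** [l] pairs individual vertices with guaranteed losses, [A] collects further vertices that lose at
    least [m] each. Weights never increase during the game, so the losses add up. *)
Lemma pot_nx (l : seq (V * nat)) (A : {set V}) m S v :
    uniq (unzip1 l) ->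
    all (fun p => wt (nx S v) p.1 + p.2 <= wt S p.1) l ->
    (forall u, u \in A -> (u \notin unzip1 l) && (wt (nx S v) u + m <= wt S u)) ->
  pot (nx S v) + (sumn (unzip2 l) + #|A| * m) <= pot S.
Proof.
move=> Ul /allP Hl HA; set S' := nx S v in Hl HA *.
have le u : wt S' u <= wt S u by apply/wt_subset/nx_subset.
have -> : pot S = pot S' + \sum_u (wt S u - wt S' u).
  by rewrite /pot -big_split /=; apply: eq_bigr => u _; rewrite subnKC.
rewrite leq_add2l.
have UlA : uniq (unzip1 l ++ enum A).
  rewrite cat_uniq Ul enum_uniq andbT; apply/hasPn => u.
  by rewrite mem_enum => /HA /andP[].
apply: (@leq_trans (\sum_(u <- unzip1 l ++ enum A) (wt S u - wt S' u))).
  rewrite big_cat /=; apply: leq_add.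
    rewrite sumnE !big_map big_seq [X in _ <= X]big_seq.
    by apply: leq_sum => p /Hl; lia.
  rewrite big_enum /= -sum_nat_const; apply: leq_sum => u /HA /andP[_]; lia.
rewrite big_uniq //= [X in _ <= X](bigID (mem (unzip1 l ++ enum A))) /=.
exact: leq_addr.
Qed.

Lemma pot_nx_seq (l : seq (V * nat)) n S v :
    n <= sumn (unzip2 l) -> uniq (unzip1 l) ->
    all (fun p => wt (nx S v) p.1 + p.2 <= wt S p.1) l ->
  pot (nx S v) + n <= pot S.
Proof.
move=> le_n Ul Hl; apply: leq_trans (_ : pot (nx S v) + sumn (unzip2 l) <= _).
  by rewrite leq_add2l.
have := @pot_nx l set0 0 S v Ul Hl.
by rewrite cards0 mul0n addn0; apply=> u; rewrite inE.
Qed.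

Hypothesis sym : symmetric e.
Hypothesis irr : irreflexive e.
Hypothesis deg : forall v, exists u, e v u.
Hypothesis tri : forall u v, e u v -> exists w, e u w && e v w.

Lemma cover u v : e u v -> exists w, e u w /\ e v w.
Proof. by move=> /tri[w /andP[]]; exists w. Qed.

Lemma wd_self S v : wd (nx S v) v = 0.
Proof.
apply/eqP; rewrite cards_eq0 -subset0; apply/subsetP => z.
by rewrite in_wn in_nx => /andP[->]; rewrite !orbT.
Qed.

(* In the [gain] lemmas, [l] lists white neighbours of the vertex that become
   dominated. *)
Lemma gain_self S v : v \notin S -> wt (nx S v) v + 45 <= wt S v.
Proof. by move=> vS; rewrite /wt (negbTE vS) in_nx eqxx orbT wd_self. Qed.

Lemma gain_self_blue g S v :
  v \in S -> g <= bw (wd S v) -> wt (nx S v) v + g <= wt S v.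
Proof. by move=> vS; rewrite /wt vS in_nx eqxx orbT wd_self. Qed.

Lemma gain_white l c S v u :
    u \notin S -> e v u ->
    uniq l -> all (fun z => [&& e u z, z \notin S & z \in nx S v]) l ->
    wd S u <= c + size l ->
  wt (nx S v) u + (45 - bw c) <= wt S u.
Proof.
move=> uS vu Ul Hl le_c; rewrite /wt (negbTE uS) in_nx vu !orbT.
have := wd_drop Ul Hl => lw.
have /bw_mono : wd (nx S v) u <= c by lia.
by have := bw_le25 c; lia.
Qed.

Lemma gain_white20 S v u :
  u \notin S -> e v u -> wt (nx S v) u + 20 <= wt S u.
Proof.
move=> uS vu; rewrite /wt (negbTE uS) in_nx vu !orbT.
by have := bw_le25 (wd (nx S v) u); lia.
Qed.

(** Only the bounds [size l] and [c] on the number of white neighbours are known. As [bw] grows by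
    18, 3, 4, 0, its drop is not monotone in that number, so each possible value is checked by
    computation. *)
Lemma gain_blue l c g S v u :
    u \in S ->
    uniq l -> all (fun z => [&& e u z, z \notin S & z \in nx S v]) l ->
    wd S u <= c ->
    all (fun a => bw (a - size l) + g <= bw a) (iota (size l) (c.+1 - size l)) ->
  wt (nx S v) u + g <= wt S u.
Proof.
move=> uS Ul Hl le_c /allP Ha; rewrite /wt uS in_nx uS /=.
have lw := wd_drop Ul Hl.
have /bw_mono : wd (nx S v) u <= wd S u - size l by lia.
have /Ha : wd S u \in iota (size l) (c.+1 - size l) by rewrite mem_iota; lia.
by lia.
Qed.

Lemma gain_blue_eq l c g S v u :
    u \in S ->
    uniq l -> all (fun z => [&& e u z, z \notin S & z \in nx S v]) l ->
    wd S u = c -> bw (c - size l) + g <= bw c ->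
  wt (nx S v) u + g <= wt S u.
Proof.
move=> uS Ul Hl Ec le_g; rewrite /wt uS in_nx uS /= Ec.
have := wd_drop Ul Hl; rewrite Ec => lw.
have /bw_mono : wd (nx S v) u <= c - size l by lia.
by lia.
Qed.

Lemma legalP S v : reflect (v \notin S \/ 0 < wd S v) (~~ (gN e v \subset S)).
Proof.
apply: (iffP subsetPn) => [[z]|].
  rewrite !inE => /predU1P[->|vz] zS; first by left.
  by right; apply/card_gt0P; exists z; rewrite in_wn vz.
case=> [vS|/card_gt0P[z]]; first by exists v; rewrite ?inE ?eqxx.
by rewrite in_wn => /andP[vz zS]; exists z; rewrite // !inE vz orbT.
Qed.

(* Closes [x != y] when [x = y] contradicts the colours, the adjacencies or the
   residual degrees in the context. *)
Ltac neq_tac := assumption || (rewrite eq_sym; assumption) ||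
  (apply/negP => /eqP ?; subst;
  first [ match goal with
  | H : is_true (?x \notin ?S), H' : is_true (?x \in ?S) |- _ =>
      by rewrite H' in H
  | H : is_true (e ?x ?x) |- _ => by rewrite irr in H
  | H : is_true (~~ e ?x ?y) |- _ =>
      by move/negP: H; apply; (assumption || (rewrite sym; assumption))
  | H : is_true (?x != ?x) |- _ => by rewrite eqxx in H
  end | lia ]).

Ltac atom := lazymatch goal with
  | |- is_true (e _ _) => assumption || (rewrite sym; assumption)
  | |- is_true (_ || _) =>
      (apply/orP; left; atom) || (apply/orP; right; atom)
  | |- is_true (?x == ?x) => exact: eqxx
  | |- is_true (~~ (_ == _)) => neq_tac
  | |- is_true (leq _ _) => assumption || lia
  | |- _ => assumption || by []
  end.
Ltac side := rewrite /= ?in_nx ?in_cons ?in_nil ?orbF ?negb_or ?andbT ?eqxx ?orbT;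
  repeat (apply/andP; split); atom.

(** A white vertex loses 45 when played. A blue one loses at least 18, and a white neighbour of it
    at least 45 - 25 = 20. *)
Lemma reply38 S v : ~~ (gN e v \subset S) -> pot (nx S v) + 38 <= pot S.
Proof.
move=> /legalP; have [vS [//|]|vS _] := boolP (v \in S); last first.
  by apply: (@pot_nx_seq [:: (v,45)]) => //=; rewrite gain_self.
move=> w0; have [z [vz zS _]] := @wd_other [::] S v w0.
apply: (@pot_nx_seq [:: (v,18); (z,20)]) => //; first by side.
by rewrite /= gain_self_blue ?bw_ge18 //= gain_white20.
Qed.

(** * Positions without a large move *)

(* No move of Dominator removes 124 = 162 - 38. *)
Definition stuck S := forall v, ~~ (gN e v \subset S) -> pot S <= pot (nx S v) + 123.

Lemma legal_white S v : v \notin S -> ~~ (gN e v \subset S).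
Proof. by move=> vS; apply/legalP; left. Qed.

Lemma legal_nbr S v (z : V) : e v z -> z \notin S -> ~~ (gN e v \subset S).
Proof.
by move=> vz zS; apply/legalP; right; apply/card_gt0P; exists z; rewrite in_wn vz.
Qed.

Lemma stuck_set l (A : {set V}) m S v : stuck S -> ~~ (gN e v \subset S) ->
    uniq (unzip1 l) ->
    all (fun p => wt (nx S v) p.1 + p.2 <= wt S p.1) l ->
    (forall u, u \in A -> (u \notin unzip1 l) && (wt (nx S v) u + m <= wt S u)) ->
  sumn (unzip2 l) + #|A| * m <= 123.
Proof.
by move=> H /H lH Ul Hl HA; rewrite -(leq_add2l (pot (nx S v))) (leq_trans _ lH) ?pot_nx.
Qed.

Lemma stuck_seq l S v : stuck S -> ~~ (gN e v \subset S) ->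
    uniq (unzip1 l) ->
    all (fun p => wt (nx S v) p.1 + p.2 <= wt S p.1) l ->
  sumn (unzip2 l) <= 123.
Proof.
by move=> H /H lH Ul Hl; rewrite -(leq_add2l (pot (nx S v))) (leq_trans _ lH) //; exact: pot_nx_seq.
Qed.

Lemma stuck_absurd l S v : stuck S -> ~~ (gN e v \subset S) ->
    123 < sumn (unzip2 l) -> uniq (unzip1 l) ->
    all (fun p => wt (nx S v) p.1 + p.2 <= wt S p.1) l ->
  False.
Proof. by move=> H lv lt Ul /(stuck_seq H lv Ul); rewrite leqNgt lt. Qed.

(** Four white neighbours would already give a drop of 45 + 4 * 20 = 125. *)
Lemma stuck_white3 S v : stuck S -> v \notin S -> wd S v <= 3.
Proof.
move=> H vS; have := @stuck_set [:: (v, 45)] (wn S v) 20 S v H (legal_white vS).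
rewrite /= gain_self // -/(wd S v) => /(_ isT isT); suff: forall u, u \in wn S v ->
    (u \notin [:: v]) && (wt (nx S v) u + 20 <= wt S u) by move=> h /(_ h); lia.
by move=> u; rewrite in_wn => /andP[vu uS]; rewrite gain_white20 // andbT; side.
Qed.

Lemma stuck_blue4 S v : stuck S -> v \in S -> wd S v <= 4.
Proof.
move=> H vS; rewrite leqNgt; apply/negP => w5.
have [z [vz zS _]] : exists z, [/\ e v z, z \notin S & z \notin nil].
  by apply: wd_other; apply: leq_trans w5.
have := @stuck_set [:: (v, 25)] (wn S v) 20 S v H (legal_nbr vz zS).
rewrite /= gain_self_blue // ?bw_ge25 ?(leq_trans _ w5) // -/(wd S v) => /(_ isT isT).
suff: forall u, u \in wn S v ->
    (u \notin [:: v]) && (wt (nx S v) u + 20 <= wt S u) by move=> h /(_ h); lia.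
by move=> u; rewrite in_wn => /andP[vu uS]; rewrite gain_white20 // andbT; side.
Qed.

(** Playing [v] removes 45 + 27 + 27 at [v], [u1], [u2]. A third white neighbour [u3] and a common
    neighbour of [v] and [u3] supply the missing 25. *)
Lemma stuck_no_diamond S v u1 u2 : stuck S ->
  v \notin S -> u1 \notin S -> u2 \notin S -> e v u1 -> e v u2 -> e u1 u2 ->
  wd S v <= 2.
Proof.
move=> H vS u1S u2S vu1 vu2 u12; rewrite leqNgt; apply/negP => v3.
have [u3 [vu3 u3S]] : exists z, [/\ e v z, z \notin S & z \notin [:: u1; u2]].
  exact: wd_other.
rewrite !inE negb_or => /andP[n31 n32].
have lv := legal_white vS.
have w1 := stuck_white3 H u1S; have w2 := stuck_white3 H u2S.
have w3 := stuck_white3 H u3S.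
have g1 : wt (nx S v) u1 + 27 <= wt S u1.
  by apply: (@gain_white [:: v; u2] 1) => //; side.
have g2 : wt (nx S v) u2 + 27 <= wt S u2.
  by apply: (@gain_white [:: v; u1] 1) => //; side.
have g0 := gain_self vS.
have [t [vt u3t]] := cover vu3; have [tS|tS] := boolP (t \in S).
  have gt : wt (nx S v) t + 4 <= wt S t.
    by apply: (@gain_blue [:: v; u3] 4) => //; [side|side|exact: stuck_blue4].
  have g3 : wt (nx S v) u3 + 24 <= wt S u3.
    by apply: (@gain_white [:: v] 2) => //; side.
  by apply: (@stuck_absurd [:: (v,45); (u1,27); (u2,27); (u3,24); (t,4)] S v) => //; side.
(* The white vertex [t] may be [u1] or [u2], so only its effect on [u3] is counted. *)
have g3 : wt (nx S v) u3 + 27 <= wt S u3.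
  by apply: (@gain_white [:: v; t] 1) => //; side.
by apply: (@stuck_absurd [:: (v,45); (u1,27); (u2,27); (u3,27)] S v) => //; side.
Qed.

(** Three white neighbours would be pairwise nonadjacent, so their edges to [v] have blue covers.
    Playing [v] removes 45 + 3 * 24 = 117, and two of the covers add 4 + 4, or 7 if they
    coincide. *)
Lemma stuck_white2 S v : stuck S -> v \notin S -> wd S v <= 2.
Proof.
move=> H vS; rewrite leqNgt; apply/negP => v3.
have lv := legal_white vS; have w3 := stuck_white3 H vS.
have nadj u u' : u \notin S -> u' \notin S -> e v u -> e v u' -> ~~ e u u'.
  move=> uS u'S vu vu'; apply/negP => uu'.
  by have := stuck_no_diamond H vS uS u'S vu vu' uu'; lia.
have cov u : u \notin S -> e v u -> exists t, [/\ t \in S, e v t & e u t].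
  move=> uS vu; have [t [vt ut]] := cover vu; exists t; split=> //.
  by apply/negPn/negP => tS; have := nadj _ _ uS tS vu vt; rewrite ut.
have gain u : u \notin S -> e v u -> wt (nx S v) u + 24 <= wt S u.
  move=> uS vu; apply: (@gain_white [:: v] 2) => //; first by side.
  exact: stuck_white3.
have [u1 [vu1 u1S _]] := @wd_other [::] S v ltac:(exact: leq_trans v3).
have [u2 [vu2 u2S]] := @wd_other [:: u1] S v ltac:(exact: leq_trans v3).
rewrite inE => n21.
have [u3 [vu3 u3S]] := @wd_other [:: u1; u2] S v v3.
rewrite !inE negb_or => /andP[n31 n32].
have [t1 [t1S vt1 ut1]] := cov _ u1S vu1.
have [t2 [t2S vt2 ut2]] := cov _ u2S vu2.
have g0 := gain_self vS; have g1 := gain _ u1S vu1.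
have g2 := gain _ u2S vu2; have g3 := gain _ u3S vu3.
have w1 := stuck_blue4 H t1S; have w2 := stuck_blue4 H t2S.
have [E|n12] := eqVneq t1 t2.
  rewrite -{}E in ut2 vt2 t2S w2.
  have gt : wt (nx S v) t1 + 7 <= wt S t1.
    by apply: (@gain_blue [:: v; u1; u2] 4) => //; side.
  by apply: (@stuck_absurd [:: (v,45); (u1,24); (u2,24); (u3,24); (t1,7)] S v) => //; side.
have gt1 : wt (nx S v) t1 + 4 <= wt S t1.
  by apply: (@gain_blue [:: v; u1] 4) => //; side.
have gt2 : wt (nx S v) t2 + 4 <= wt S t2.
  by apply: (@gain_blue [:: v; u2] 4) => //; side.
by apply: (@stuck_absurd [:: (v,45); (u1,24); (u2,24); (u3,24); (t1,4); (t2,4)] S v) => //; side.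
Qed.

Lemma stuck_cover3 S u v t : stuck S -> u \notin S -> v \notin S -> t \in S ->
  e u v -> e t u -> e t v -> wd S t <= 3.
Proof.
move=> H uS vS tS uv tu tv; rewrite leqNgt; apply/negP => w4.
have [y [ty yS]] := @wd_other [:: u; v] S t ltac:(exact: leq_trans w4).
rewrite !inE negb_or => /andP[nyu nyv].
have [z [tz zS]] := @wd_other [:: u; v; y] S t w4.
rewrite !inE !negb_or => /and3P[nzu nzv nzy].
have wu := stuck_white2 H uS; have wv := stuck_white2 H vS.
have wy := stuck_white2 H yS; have wz := stuck_white2 H zS.
have gt : wt (nx S t) t + 25 <= wt S t by apply/gain_self_blue/bw_ge25/ltnW.
have gu : wt (nx S t) u + 27 <= wt S u by apply: (@gain_white [:: v] 1) => //; side.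
have gv : wt (nx S t) v + 27 <= wt S v by apply: (@gain_white [:: u] 1) => //; side.
have gy : wt (nx S t) y + 24 <= wt S y by apply: (@gain_white [::] 2).
have gz : wt (nx S t) z + 24 <= wt S z by apply: (@gain_white [::] 2).
apply: (@stuck_absurd [:: (t,25); (u,27); (v,27); (y,24); (z,24)] S t) => //; try by side.
exact: legal_nbr tu uS.
Qed.

(** Playing [u] leaves [v] and [z] without white neighbours, since each has at most two; all three
    lose 45. *)
Lemma stuck_triangle_free S u v z : stuck S ->
  u \notin S -> v \notin S -> z \notin S -> e u v -> e u z -> ~~ e v z.
Proof.
move=> H uS vS zS uv uz; apply/negP => vz.
have wv := stuck_white2 H vS; have wz := stuck_white2 H zS.
have gu := gain_self uS.
have gv : wt (nx S u) v + 45 <= wt S v.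
  by apply: (@gain_white [:: u; z] 0) => //; side.
have gz : wt (nx S u) z + 45 <= wt S z.
  by apply: (@gain_white [:: u; v] 0) => //; side.
by apply: (@stuck_absurd [:: (u,45); (v,45); (z,45)] S u) => //; [exact: legal_white|side|side].
Qed.

Lemma stuck_cover S u v : stuck S -> u \notin S -> v \notin S -> e u v ->
  exists t, [/\ t \in S, e u t, e v t, 1 < wd S t & wd S t <= 3].
Proof.
move=> H uS vS uv; have [t [ut vt]] := cover uv.
have tS : t \in S.
  apply/negPn/negP => tS.
  by have := stuck_triangle_free H uS vS tS uv ut; rewrite vt.
exists t; split=> //; first by apply: (@wd_ge [:: u; v]) => //; side.
by apply: (@stuck_cover3 S u v) => //; rewrite sym.
Qed.

(** Playing a common cover [t] would also use up both white neighbours of [v], for a drop of 25 + 45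
    + 27 + 27 = 124. *)
Lemma stuck_cover_inj S v u1 u2 t : stuck S ->
  v \notin S -> u1 \notin S -> u2 \notin S -> t \in S ->
  e v u1 -> e v u2 -> u1 != u2 -> e t v -> e t u1 -> ~~ e t u2.
Proof.
move=> H vS u1S u2S tS vu1 vu2 n12 tv tu1; apply/negP => tu2.
have wv := stuck_white2 H vS.
have w1 := stuck_white2 H u1S; have w2 := stuck_white2 H u2S.
have gt : wt (nx S t) t + 25 <= wt S t.
  by apply/gain_self_blue/bw_ge25 => //; apply: (@wd_ge [:: v; u1; u2]); side.
have gv : wt (nx S t) v + 45 <= wt S v.
  by apply: (@gain_white [:: u1; u2] 0) => //; side.
have g1 : wt (nx S t) u1 + 27 <= wt S u1 by apply: (@gain_white [:: v] 1) => //; side.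
have g2 : wt (nx S t) u2 + 27 <= wt S u2 by apply: (@gain_white [:: v] 1) => //; side.
apply: (@stuck_absurd [:: (t,25); (v,45); (u1,27); (u2,27)] S t) => //; try by side.
exact: legal_nbr tv vS.
Qed.

(* The white edges at [v] have different covers [t1] and [t2], so playing [v]
   takes two white neighbours away from each of them; if [t1] or [u1] had fewer
   white neighbours than claimed, this would remove at least 124. *)
Lemma stuck_degree2 S v u1 u2 t1 t2 : stuck S ->
  v \notin S -> u1 \notin S -> u2 \notin S -> e v u1 -> e v u2 -> u1 != u2 ->
  t1 \in S -> e t1 v -> e t1 u1 -> t2 \in S -> e t2 v -> e t2 u2 ->
  [/\ t1 != t2, wd S t1 = 3 & wd S u1 = 2].
Proof.
move=> H vS u1S u2S vu1 vu2 n12 t1S t1v t1u t2S t2v t2u.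
have nt : t1 != t2.
  apply/eqP => E; rewrite -E in t2u.
  by have := stuck_cover_inj H vS u1S u2S t1S vu1 vu2 n12 t1v t1u; rewrite t2u.
have lv := legal_white vS.
have wv := stuck_white2 H vS.
have w1 := stuck_white2 H u1S; have w2 := stuck_white2 H u2S.
have k1 : wd S t1 <= 3 by apply: (@stuck_cover3 S v u1).
have k2 : wd S t2 <= 3 by apply: (@stuck_cover3 S v u2).
have k1' : 2 <= wd S t1 by apply: (@wd_ge [:: v; u1]) => //; side.
have g0 := gain_self vS.
have gu1 : wt (nx S v) u1 + 27 <= wt S u1 by apply: (@gain_white [:: v] 1) => //; side.
have gu2 : wt (nx S v) u2 + 27 <= wt S u2 by apply: (@gain_white [:: v] 1) => //; side.
have gt1 : wt (nx S v) t1 + 7 <= wt S t1 by apply: (@gain_blue [:: v; u1] 3) => //; side.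
have gt2 : wt (nx S v) t2 + 7 <= wt S t2 by apply: (@gain_blue [:: v; u2] 3) => //; side.
split=> //.
  apply/eqP; rewrite eqn_leq k1 ltnNge; apply/negP => k1''.
  have gt1' : wt (nx S v) t1 + 21 <= wt S t1.
    by apply: (@gain_blue [:: v; u1] 2) => //; side.
  by apply: (@stuck_absurd [:: (v,45); (u1,27); (u2,27); (t1,21); (t2,7)] S v) => //; side.
apply/eqP; rewrite eqn_leq w1 ltnNge; apply/negP => w1'.
have gu1' : wt (nx S v) u1 + 45 <= wt S u1.
  by apply: (@gain_white [:: v] 0) => //; side.
by apply: (@stuck_absurd [:: (v,45); (u1,45); (u2,27); (t1,7); (t2,7)] S v) => //; side.
Qed.

(** * Staller's replies and Dominator's moves *)

(** The threshold 61 completes the drop of at least 101 that [good_intro] asks of Dominator's move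
    to 162. The two cheaper kinds of reply are treated separately. *)
Lemma reply_cases S v : ~~ (gN e v \subset S) ->
  [\/ pot (nx S v) + 61 <= pot S,
      v \notin S /\ wd S v = 0 |
      [/\ v \in S, wd S v = 1 &
         exists w z, [/\ w \notin S, z \notin S, e v w & e w z]]].
Proof.
move=> /legalP; have [vS [//|w0]|vS _] := boolP (v \in S); last first.
  have [w0|w0] := posnP (wd S v); first by constructor 2.
  have [z [vz zS _]] := @wd_other [::] S v w0; constructor 1.
  have g0 := gain_self vS; have gz := gain_white20 zS vz.
  by apply: (@pot_nx_seq [:: (v,45); (z,20)]) => //; side.
have [w1|w1] := leqP (wd S v) 1; last first.
  have [z [vz zS _]] := @wd_other [::] S v w0; constructor 1.
  have [y [vy yS]] := @wd_other [:: z] S v w1.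
  rewrite inE => nyz.
  have g0 : wt (nx S v) v + 21 <= wt S v by apply/gain_self_blue/bw_ge21.
  have gz := gain_white20 zS vz; have gy := gain_white20 yS vy.
  by apply: (@pot_nx_seq [:: (v,21); (z,20); (y,20)]) => //; side.
have [w [vw wS _]] := @wd_other [::] S v w0.
have [ww|ww] := posnP (wd S w).
  constructor 1.
  have g0 : wt (nx S v) v + 18 <= wt S v by apply/gain_self_blue/bw_ge18.
  have gw : wt (nx S v) w + 45 <= wt S w.
    by apply: (@gain_white [::] 0) => //; rewrite ww.
  by apply: (@pot_nx_seq [:: (v,18); (w,45)]) => //; side.
have [z [wz zS _]] := @wd_other [::] S w ww.
by constructor 3; split; [|lia|exists w, z].
Qed.

Lemma two_nbrs v : exists u1 u2, [/\ e v u1, e v u2 & u1 != u2].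
Proof.
have [u vu] := deg v; have [w [vw uw]] := cover vu.
by exists u, w; split=> //; apply: contraTneq uw => ->; rewrite irr.
Qed.

(** The two neighbours provided by [two_nbrs] are blue. With at most three white neighbours each,
    losing [v] costs them at least 3; with four it could cost nothing. *)
Lemma reply_isolated S v : v \notin S -> wd S v = 0 ->
  (forall u, e v u -> wd S u <= 3) -> pot (nx S v) + 51 <= pot S.
Proof.
move=> vS w0 w3; have [u1 [u2 [vu1 vu2 n12]]] := two_nbrs v.
have u1S := wd_eq0 w0 vu1; have u2S := wd_eq0 w0 vu2.
have g0 := gain_self vS.
have g1 : wt (nx S v) u1 + 3 <= wt S u1.
  by apply: (@gain_blue [:: v] 3) => //; [side|exact: w3].
have g2 : wt (nx S v) u2 + 3 <= wt S u2.
  by apply: (@gain_blue [:: v] 3) => //; [side|exact: w3].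
by apply: (@pot_nx_seq [:: (v,45); (u1,3); (u2,3)]) => //; side.
Qed.

(* Staller's cheapest reply: a blue vertex [x] whose only white neighbour [w] is
   not isolated among the white vertices. *)
Lemma reply_leaf c S x w z t : x \in S -> wd S x = 1 -> w \notin S -> z \notin S ->
    t \in S -> e x w -> e w z -> e w t -> e z t -> wd S w <= c -> wd S t <= 3 ->
  pot (nx S x) + (21 + (45 - bw c)) <= pot S.
Proof.
move=> xS wx wS zS tS xw wz wt' zt wc w3.
have wt2 : 1 < wd S t by apply: (@wd_ge [:: w; z]) => //; side.
have gx : wt (nx S x) x + 18 <= wt S x by apply/gain_self_blue/bw_ge18; rewrite // wx.
have gw : wt (nx S x) w + (45 - bw c) <= wt S w.
  by apply: (@gain_white [::] c) => //; rewrite addn0.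
have gt : wt (nx S x) t + 3 <= wt S t.
  by apply: (@gain_blue [:: w] 3) => //; side.
apply: (@pot_nx_seq [:: (x,18); (w, 45 - bw c); (t,3)]) => /=; first lia; side.
Qed.

(** The bound 81 pays for a move that ends the game, the bound 162 for a full round. *)
Definition good S v := [/\ ~~ (gN e v \subset S), pot (nx S v) + 81 <= pot S &
  forall v', ~~ (gN e v' \subset nx S v) -> pot (nx (nx S v) v') + 162 <= pot S].

Lemma good_intro a S v : ~~ (gN e v \subset S) -> 101 <= a ->
    pot (nx S v) + a <= pot S ->
    (forall x, x \notin nx S v -> wd (nx S v) x = 0 ->
       pot (nx (nx S v) x) + (162 - a) <= pot (nx S v)) ->
    (forall x w z, x \in nx S v -> wd (nx S v) x = 1 ->
       w \notin nx S v -> z \notin nx S v -> e x w -> e w z ->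
       pot (nx (nx S v) x) + (162 - a) <= pot (nx S v)) ->
  good S v.
Proof.
move=> lv le_a D R0 R1; split=> // [|x /reply_cases[|[xS' wx]|]]; [lia|lia| |].
  by have := R0 x xS' wx; lia.
by case=> xS' wx [w [z [wS' zS' xw wz]]]; have := R1 x w z xS' wx wS' zS' xw wz; lia.
Qed.

Lemma notin_nx S v u : u \notin nx S v -> u \notin S.
Proof. by apply: contra; rewrite in_nx => ->. Qed.

(* Besides [v], its two white neighbours and the covers [t1], [t2] of the edges
   at [v], the cover [t] of the next white edge [u1 z] also loses weight. *)
Lemma stuck_degree2_good S v : stuck S -> v \notin S -> wd S v = 2 -> good S v.
Proof.
move=> H vS w2.
have [u1 [vu1 u1S _]] := @wd_other [::] S v ltac:(rewrite w2; exact: isT).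
have [u2 [vu2 u2S]] := @wd_other [:: u1] S v ltac:(rewrite w2; exact: isT).
rewrite inE => n21.
have [t1 [t1S vt1 ut1 _ k1]] := stuck_cover H vS u1S vu1.
have [t2 [t2S vt2 ut2 _ k2]] := stuck_cover H vS u2S vu2.
have [nt _ wu1] : [/\ t1 != t2, wd S t1 = 3 & wd S u1 = 2].
  by apply: (@stuck_degree2 S v u1 u2); rewrite // 1?sym // eq_sym.
have [z [uz zS]] := @wd_other [:: v] S u1 ltac:(rewrite wu1; exact: isT).
rewrite inE => nzv.
have [t [tS ut zt _ _]] := stuck_cover H u1S zS uz.
(* The same structure is read off at [u1], whose white neighbours are [z] and [v]. Hence [t] drops
   from three white neighbours to at most two and loses 25 - 21 = 4. *)
have [nt1 k _] : [/\ t != t1, wd S t = 3 & wd S z = 2].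
  by apply: (@stuck_degree2 S u1 z v); rewrite // 1?sym.
have nt2 : t != t2.
  apply/eqP => E; rewrite E in ut.
  have := @stuck_cover_inj S v u1 u2 t2 H vS u1S u2S t2S vu1 vu2.
  by rewrite eq_sym n21 ![e t2 _]sym vt2 ut ut2 => /(_ isT isT isT).
have wv := stuck_white2 H vS.
have w1' := stuck_white2 H u1S; have w2' := stuck_white2 H u2S.
have g0 := gain_self vS.
have gu1 : wt (nx S v) u1 + 27 <= wt S u1 by apply: (@gain_white [:: v] 1) => //; side.
have gu2 : wt (nx S v) u2 + 27 <= wt S u2 by apply: (@gain_white [:: v] 1) => //; side.
have gt1 : wt (nx S v) t1 + 7 <= wt S t1 by apply: (@gain_blue [:: v; u1] 3) => //; side.
have gt2 : wt (nx S v) t2 + 7 <= wt S t2 by apply: (@gain_blue [:: v; u2] 3) => //; side.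
have gt : wt (nx S v) t + 4 <= wt S t by apply: (@gain_blue_eq [:: u1] 3) => //; side.
have D : pot (nx S v) + 117 <= pot S.
  by apply: (@pot_nx_seq [:: (v,45); (u1,27); (u2,27); (t1,7); (t2,7); (t,4)]) => //; side.
(* The missing 162 - 117 = 45 is the weight of an isolated white vertex, and also the bound 21 + (45
   - 21) of [reply_leaf]. *)
apply: (good_intro (legal_white vS) _ D) => // [x xS' _|x w y xS' wx wS' yS' xw wy].
  by apply: (@pot_nx_seq [:: (x,45)]) => //=; rewrite gain_self.
have [wS yS] := (notin_nx wS', notin_nx yS').
have [s [sS ws ys _ ks]] := stuck_cover H wS yS wy.
have le := fun r => wd_subset r (nx_subset S v).
apply: (@reply_leaf 2 _ x w y s) => //; first by rewrite in_nx sS.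
  exact: leq_trans (le w) (stuck_white2 H wS).
exact: leq_trans (le s) ks.
Qed.

(** * Stuck positions whose white edges form a matching *)

Section Matching.
Variable S : {set V}.
Hypothesis H : stuck S.
Hypothesis M : forall v, v \notin S -> wd S v <= 1.

Lemma matching_blue3 v : wd S v <= 3.
Proof.
have [vS|vS] := boolP (v \in S); last by apply: leq_trans (M vS) _.
rewrite leqNgt; apply/negP => w4.
have [z [vz zS _]] := @wd_other [::] S v ltac:(exact: leq_trans w4).
have g0 : wt (nx S v) v + 25 <= wt S v by apply/gain_self_blue/bw_ge25/ltnW.
have := @stuck_set [:: (v, 25)] (wn S v) 27 S v H (legal_nbr vz zS).
rewrite /= g0 -/(wd S v) => /(_ isT isT).
suff: forall u, u \in wn S v ->
    (u \notin [:: v]) && (wt (nx S v) u + 27 <= wt S u) by move=> h /(_ h); lia.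
move=> u; rewrite in_wn => /andP[vu uS]; apply/andP; split; first by side.
by apply: (@gain_white [::] 1) => //; rewrite addn0 M.
Qed.

Lemma matching_cover2 u v t : u \notin S -> v \notin S -> e u v ->
  t \in S -> e u t -> e v t -> wd S t = 2.
Proof.
move=> uS vS uv tS ut vt; apply/eqP; rewrite eqn_leq (@wd_ge [:: u; v]) ?andbT //; try by side.
rewrite leqNgt; apply/negP => k3.
have [y [ty yS]] := @wd_other [:: u; v] S t k3.
rewrite !inE negb_or => /andP[nyu nyv].
have wu := M uS; have wv := M vS; have wy := M yS.
have gt : wt (nx S t) t + 25 <= wt S t by apply/gain_self_blue/bw_ge25.
have gu : wt (nx S t) u + 45 <= wt S u by apply: (@gain_white [:: v] 0) => //; side.
have gv : wt (nx S t) v + 45 <= wt S v by apply: (@gain_white [:: u] 0) => //; side.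
have gy : wt (nx S t) y + 27 <= wt S y by apply: (@gain_white [::] 1) => //; side.
apply: (@stuck_absurd [:: (t,25); (u,45); (v,45); (y,27)] S t) => //; try by side.
by apply: (@legal_nbr _ _ y).
Qed.

Lemma matching_gain u v t : u \notin S -> v \notin S -> e u v ->
    t \in S -> e u t -> e v t ->
  [/\ wt (nx S u) u + 45 <= wt S u, wt (nx S u) v + 45 <= wt S v &
      wt (nx S u) t + 21 <= wt S t].
Proof.
move=> uS vS uv tS ut vt; have k := matching_cover2 uS vS uv tS ut vt.
have wv := M vS; split; first exact: gain_self.
  by apply: (@gain_white [:: u] 0) => //; side.
by apply: (@gain_blue_eq [:: u; v] 2) => //; side.
Qed.

(** Playing [u] removes 45 + 45 + 21 at the edge and its cover; a blue neighbour with [u] as its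
    only white neighbour would add 18. *)
Lemma matching_leaf u v x : u \notin S -> v \notin S -> e u v ->
  x \in S -> e u x -> 1 < wd S x.
Proof.
move=> uS vS uv xS ux; rewrite ltnNge; apply/negP => w1.
have [t [tS ut vt k _]] := stuck_cover H uS vS uv.
have [gu gv gt] := matching_gain uS vS uv tS ut vt.
have wx : wd S x = 1.
  by apply/eqP; rewrite eqn_leq w1 (@wd_ge [:: u]) //; side.
have gx : wt (nx S u) x + 18 <= wt S x by apply: (@gain_blue_eq [:: u] 1) => //; side.
apply: (@stuck_absurd [:: (u,45); (v,45); (t,21); (x,18)] S u) => //; try by side.
exact: legal_white.
Qed.

Lemma matching_reply_isolated u x : x \notin nx S u -> wd (nx S u) x = 0 ->
  pot (nx (nx S u) x) + 51 <= pot (nx S u).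
Proof.
move=> xS w0; apply: reply_isolated => // y _.
exact: leq_trans (wd_subset y (nx_subset S u)) (matching_blue3 y).
Qed.

(* The drop 111 of the plain edge move is improved by the extra blue neighbour
   [y]; without one, Staller has no reply of the kind of [reply_leaf]. *)
Lemma matching_extra_good u v t y : u \notin S -> v \notin S -> e u v ->
  t \in S -> e u t -> e v t -> y \in S -> e u y -> y != t -> good S u.
Proof.
move=> uS vS uv tS ut vt yS uy nyt.
have [gu gv gt] := matching_gain uS vS uv tS ut vt.
have wy1 := matching_leaf uS vS uv yS uy; have wy3 := matching_blue3 y.
have gy : wt (nx S u) y + 3 <= wt S y by apply: (@gain_blue [:: u] 3) => //; side.
have D : pot (nx S u) + 114 <= pot S.
  by apply: (@pot_nx_seq [:: (u,45); (v,45); (t,21); (y,3)]) => //; side.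
(* The missing 162 - 114 = 48 is below 51 for isolated vertices and equals the bound 21 + (45 - 18)
   of [reply_leaf]. *)
apply: (good_intro (legal_white uS) _ D) => // [x xS' wx|x w z xS' wx wS' zS' xw wz].
  by apply: leq_trans (matching_reply_isolated xS' wx); rewrite leq_add2l.
have [wS zS] := (notin_nx wS', notin_nx zS').
have [s [sS ws zs _ ks]] := stuck_cover H wS zS wz.
have le := fun r => wd_subset r (nx_subset S u).
apply: (@reply_leaf 1 _ x w z s) => //; first by rewrite in_nx sS.
  exact: leq_trans (le w) (M wS).
exact: leq_trans (le s) ks.
Qed.

(** The drop 111 and the 51 of an isolated reply give 162 exactly. A leaf reply [x] next to a white
    edge [w z] is impossible: if already blue, [x] would be the cover of that edge, which still sees
    both ends. *)
Lemma matching_edge_good u v : u \notin S -> v \notin S -> e u v ->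
    (forall w z t y, w \notin S -> z \notin S -> e w z ->
       t \in S -> e w t -> e z t -> y \in S -> e w y -> y = t) ->
  good S u.
Proof.
move=> uS vS uv uniq_cover.
have [t [tS ut vt _ _]] := stuck_cover H uS vS uv.
have [gu gv gt] := matching_gain uS vS uv tS ut vt.
have D : pot (nx S u) + 111 <= pot S.
  by apply: (@pot_nx_seq [:: (u,45); (v,45); (t,21)]) => //; side.
apply: (good_intro (legal_white uS) _ D) => // [x xS' wx|x w z xS' wx wS' zS' xw wz].
  exact: matching_reply_isolated.
have [wS zS] := (notin_nx wS', notin_nx zS').
have [s [sS ws zs _ _]] := stuck_cover H wS zS wz.
have [xS|xS] := boolP (x \in S).
  have E := uniq_cover w z s x wS zS wz sS ws zs xS ltac:(by rewrite sym).
  suff: 1 < wd (nx S u) s by rewrite -E wx.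
  by apply: (@wd_ge [:: w; z]) => //; rewrite /= ?[e s _]sym ?ws ?zs ?wS' ?zS' ?inE; side.
(* Otherwise [x] has just become blue. It is not [u], which has no white neighbour left, so it had
   [u] and one more white neighbour, against [M]. *)
move: xS'; rewrite in_nx (negbTE xS) /= => /predU1P[E|ux].
  by rewrite E wd_self in wx.
have : wd (nx S u) x + 1 <= wd S x.
  by apply: (@wd_drop [:: u]) => //; side.
by rewrite wx => /leq_trans /(_ (M xS)).
Qed.

(** * Stuck positions without white edges *)

Hypothesis I : forall v, v \notin S -> wd S v = 0.

Lemma isolated_blue2 v : wd S v <= 2.
Proof.
have [vS|vS] := boolP (v \in S); last by rewrite I.
rewrite leqNgt; apply/negP => w3.
have [z [vz zS _]] := @wd_other [::] S v ltac:(exact: leq_trans w3).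
have g0 : wt (nx S v) v + 25 <= wt S v by apply/gain_self_blue/bw_ge25.
have := @stuck_set [:: (v, 25)] (wn S v) 45 S v H (legal_nbr vz zS).
rewrite /= g0 -/(wd S v) => /(_ isT isT).
suff: forall u, u \in wn S v ->
    (u \notin [:: v]) && (wt (nx S v) u + 45 <= wt S u) by move=> h /(_ h); lia.
move=> u; rewrite in_wn => /andP[vu uS]; apply/andP; split; first by side.
by apply: (@gain_white [::] 0) => //; rewrite addn0 I.
Qed.

Lemma isolated_no_white_edge u w z :
  w \notin nx S u -> z \notin nx S u -> ~~ e w z.
Proof.
move=> /notin_nx wS /notin_nx zS; apply/negP => wz.
by have := @wd_ge [:: z] S w isT; rewrite I //= wz zS => /(_ isT).
Qed.

(** The drop is 21 + 45 + 45 = 111, an isolated reply adds 51, and leaf replies need a white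
    edge. *)
Lemma isolated_blue2_good t : wd S t = 2 -> good S t.
Proof.
move=> w2; have tS : t \in S by apply/negPn/negP => /I; lia.
have [u [tu uS _]] := @wd_other [::] S t ltac:(rewrite w2; exact: isT).
have [v [tv vS]] := @wd_other [:: u] S t ltac:(rewrite w2; exact: isT).
rewrite inE => nvu; have wu := I uS; have wv := I vS.
have gt : wt (nx S t) t + 21 <= wt S t by apply/gain_self_blue; rewrite // w2.
have gu : wt (nx S t) u + 45 <= wt S u by apply: (@gain_white [::] 0) => //; side.
have gv : wt (nx S t) v + 45 <= wt S v by apply: (@gain_white [::] 0) => //; side.
have D : pot (nx S t) + 111 <= pot S.
  by apply: (@pot_nx_seq [:: (t,21); (u,45); (v,45)]) => //; side.
apply: (good_intro (legal_nbr tu uS) _ D) => // [x xS' wx|x w z xS' wx wS' zS' xw wz].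
  exact: matching_reply_isolated.
by have := isolated_no_white_edge wS' zS'; rewrite wz.
Qed.

End Matching.

(** * Positions where each blue vertex has at most one white neighbour and no white edge remains *)

Lemma private_white S v : v \notin S -> wd S v = 0 ->
  (forall u, u \in S -> wd S u <= 1) -> pot (nx S v) + 81 <= pot S.
Proof.
move=> vS w0 w1; have [u1 [u2 [vu1 vu2 n12]]] := two_nbrs v.
have u1S := wd_eq0 w0 vu1; have u2S := wd_eq0 w0 vu2.
have g u : u \in S -> e v u -> wt (nx S v) u + 18 <= wt S u.
  move=> uS vu; apply: (@gain_blue_eq [:: v] 1) => //; first by side.
  by apply/eqP; rewrite eqn_leq w1 //= (@wd_ge [:: v]) //; side.
have g0 := gain_self vS; have g1 := g _ u1S vu1; have g2 := g _ u2S vu2.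
by apply: (@pot_nx_seq [:: (v,45); (u1,18); (u2,18)]) => //; side.
Qed.

(** The third vertex [y] of a triangle on [x] and its white neighbour [w] is blue and loses 18 as
    well: 18 + 45 + 18 = 81. *)
Lemma private_blue S x : x \in S -> 0 < wd S x ->
  (forall v, v \notin S -> wd S v = 0) ->
  (forall u, u \in S -> wd S u <= 1) -> pot (nx S x) + 81 <= pot S.
Proof.
move=> xS x1 w0 w1; have [w [xw wS _]] := @wd_other [::] S x x1.
have [y [xy wy]] := cover xw; have ww := w0 _ wS.
have yS := wd_eq0 ww wy.
have kx : wd S x = 1 by apply/eqP; rewrite eqn_leq w1.
have ky : wd S y = 1 by apply/eqP; rewrite eqn_leq w1 //= (@wd_ge [:: w]) //; side.
have gx : wt (nx S x) x + 18 <= wt S x by apply/gain_self_blue; rewrite // kx.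
have gw : wt (nx S x) w + 45 <= wt S w by apply: (@gain_white [::] 0) => //; side.
have gy : wt (nx S x) y + 18 <= wt S y by apply: (@gain_blue_eq [:: w] 1) => //; side.
by apply: (@pot_nx_seq [:: (x,18); (w,45); (y,18)]) => //; side.
Qed.

(** Both hypotheses on the position survive any move, so Dominator's move and Staller's reply each
    remove 81. *)
Lemma private_good S v : v \notin S ->
  (forall v, v \notin S -> wd S v = 0) ->
  (forall u, u \in S -> wd S u <= 1) -> good S v.
Proof.
move=> vS w0 w1; have D := private_white vS (w0 _ vS) w1.
have le := fun r => wd_subset r (nx_subset S v).
have w0' u : u \notin nx S v -> wd (nx S v) u = 0.
  by move=> /notin_nx /w0; have := le u; lia.
have w1' u : u \in nx S v -> wd (nx S v) u <= 1.
  by have [/w1|/w0] := boolP (u \in S); have := le u; lia.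
split=> [||x /legalP lx]; [exact: legal_white|by []|].
suff: pot (nx (nx S v) x) + 81 <= pot (nx S v) by lia.
have [xS'|xS'] := boolP (x \in nx S v); last exact: private_white (w0' _ xS') w1'.
by case: lx => [|x1]; [rewrite xS'|exact: private_blue].
Qed.

Lemma good_exists S : S != setT -> exists v, good S v.
Proof.
move=> SnT.
have [/existsP[v /andP[lv D]]|/existsPn ns] :=
  boolP [exists v, ~~ (gN e v \subset S) && (pot (nx S v) + 124 <= pot S)].
  by exists v; split=> // [|x /reply38]; lia.
have H : stuck S by move=> v lv; have := ns v; rewrite lv /=; lia.
have [/existsP[v /andP[vS /eqP w2]]|/existsPn n2] :=
  boolP [exists v, (v \notin S) && (wd S v == 2)].
  by exists v; exact: stuck_degree2_good.
have M v : v \notin S -> wd S v <= 1.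
  by move=> vS; have := stuck_white2 H vS; have := n2 v; rewrite vS /=; lia.
(* This search precedes the one for a white edge because its failure is the uniqueness hypothesis of
   [matching_edge_good]. *)
have [/existsP[u /existsP[v /existsP[t /existsP[y]]]]|nx4] :=
  boolP [exists u, exists v, exists t, exists y,
    [&& [&& u \notin S, v \notin S & e u v], [&& t \in S, e u t & e v t],
        y \in S, e u y & y != t]].
  case/and5P=> /and3P[uS vS uv] /and3P[tS ut vt] yS uy yt.
  by exists u; exact: (matching_extra_good H M uS vS uv tS ut vt yS uy yt).
have [/existsP[u /andP[uS u1]]|/existsPn n1] :=
  boolP [exists v, (v \notin S) && (0 < wd S v)].
  have [v [uv vS _]] := @wd_other [::] S u u1.
  exists u; apply: (matching_edge_good H M uS vS uv) => w z t y wS zS wz tS wt' zt yS wy.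
  apply/eqP/negPn/negP => yt; case/negP: nx4.
  apply/existsP; exists w; apply/existsP; exists z; apply/existsP; exists t.
  by apply/existsP; exists y; rewrite wS zS wz tS wt' zt yS wy yt.
have I v : v \notin S -> wd S v = 0.
  by move=> vS; have := n1 v; rewrite vS /=; lia.
have [/existsP[t /eqP t2]|/existsPn nt] := boolP [exists t, wd S t == 2].
  by exists t; exact: isolated_blue2_good.
have [v vS] : exists v, v \notin S.
  apply/existsP; rewrite -negb_forall; apply: contra SnT => /forallP all_S.
  by apply/eqP/setP => v; rewrite all_S inE.
exists v; apply: private_good => // u _.
by have := isolated_blue2 H I u; have := nt u; lia.
Qed.

(** * The value of the game *)

(** The default [n] can only lower the minimum, so it may be arbitrary. *)
Lemma bigmin_le (I : eqType) (r : seq I) (P : pred I) (F : I -> nat) n i :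
  i \in r -> P i -> \big[minn/n]_(j <- r | P j) F j <= F i.
Proof.
elim: r => // j r IHr; rewrite inE big_cons => /predU1P[<- ->|ir Pi].
  exact: geq_minl.
case: ifP => _; last exact: IHr.
exact: leq_trans (geq_minr _ _) (IHr ir Pi).
Qed.

(** The bound holds for every amount of fuel, as running out only shortens the count. The induction
    is strong because a round uses two units. *)
Lemma game_val_pot k S : 81 * game_val (gN e) k true S <= pot S.
Proof.
elim/ltn_ind: k S => -[|k] IHk S; first by rewrite muln0.
rewrite /=; case: ifP => // /negbT /good_exists[v [lv D R]].
apply: leq_trans (_ : 81 * (game_val (gN e) k false (nx S v)).+1 <= _).
  by rewrite leq_mul2l bigmin_le // mem_index_enum.
case: k IHk => [|k] IHk /=; first by lia.
case: ifP => _; first by lia.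
rewrite -ltnS; set m := \max_(_ | _) _.
suff: 81 * m.+1 <= pot S by lia.
(* The neutral value 0 of the maximum is paid by the drop 81 of Dominator's own move. *)
rewrite /m; elim/big_ind: _ => [|a b Ha Hb|x lx]; first by lia.
  by rewrite /maxn; case: ifP.
by have := IHk k (leqnSn _) (nx (nx S v) x); have := R x lx; rewrite -/(nx _ _); lia.
Qed.

Lemma gamma_g'_bound : 9 * gamma_g' (gN e) <= 5 * #|V|.
Proof.
have p0 : pot set0 = 45 * #|V|.
  rewrite /pot (eq_bigr (fun=> 45)) ?sum_nat_const ?cardT' 1?mulnC // => u _.
  by rewrite /wt inE.
suff : 81 * gamma_g' (gN e) <= pot set0 by rewrite p0; lia.
rewrite /gamma_g'; case: #|V| => [|k] /=; first by lia.
case: ifP => // _; elim/big_ind: _ => [|a b Ha Hb|x _]; first by lia.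
  by rewrite /maxn; case: ifP.
have xS : x \notin set0 by rewrite inE.
have [u1 [u2 [xu1 xu2 n12]]] := two_nbrs x.
have D : pot (nx set0 x) + 81 <= pot set0.
  have u1S : u1 \notin set0 by rewrite inE.
  have u2S : u2 \notin set0 by rewrite inE.
  have g0 := gain_self xS; have g1 := gain_white20 u1S xu1.
  have g2 := gain_white20 u2S xu2.
  by apply: (@pot_nx_seq [:: (x,45); (u1,20); (u2,20)]) => //; side.
by have := game_val_pot k (nx set0 x); rewrite -/(nx _ _); lia.
Qed.

End Potential.

Theorem theorem4 :
  (forall (V : finType) (E : {set {set V}}),
      (forall e, e \in E -> #|e| = 3) ->
      (forall v : V, exists2 e, e \in E & v \in e) ->
      9 * gamma_g' (hN E) <= 5 * #|V|)
  /\
  (forall (V : finType) (e : rel V),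
      symmetric e -> irreflexive e ->
      (forall v : V, exists u, e v u) ->
      (forall u v : V, e u v -> exists w, e u w && e v w) ->
      9 * gamma_g' (gN e) <= 5 * #|V|).
Proof.
split=> V; last by move=> e sym irr deg tri; exact: gamma_g'_bound.
(* [hN E] unfolds to [gN (hadj E)]: the game is played on the 2-section graph, where the third
   vertex of a hyperedge completes each edge to a triangle. *)
move=> E card3 cov; apply: (@gamma_g'_bound V (hadj E)).
- move=> u v; rewrite /hadj eq_sym; congr (_ && _).
  by apply: eq_existsb => a; rewrite [(u \in a) && _]andbC.
- by move=> u; rewrite /hadj eqxx.
- move=> v; have [a aE va] := cov v.
  have /card_gt0P[u] : 0 < #|a :\ v|.
    by have := cardsD1 v a; rewrite va card3 // add1n => -[<-].
  rewrite !inE => /andP[uv ua]; exists u; rewrite /hadj eq_sym uv /=.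
  by apply/existsP; exists a; rewrite aE va ua.
move=> u v /andP[uv /existsP[a /and3P[aE ua va]]].
have /card_gt0P[w] : 0 < #|a :\ u :\ v|.
  have := cardsD1 v (a :\ u); have := cardsD1 u a.
  by rewrite !inE eq_sym uv va ua card3 // !add1n => -[<-] [<-].
rewrite !inE => /and3P[wv wu wa]; exists w; rewrite /hadj ![_ == w]eq_sym wu wv /=.
by apply/andP; split; apply/existsP; exists a; rewrite aE wa ?ua ?va.
Qed.
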